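(* Let $m\ge 1$ be an integer, let $P_1(\theta)=A_1^1\cos\theta+B_1^1\sin\theta$ with real $A_1^1,B_1^1$ satisfying $(A_1^1)^2+(B_1^1)^2\ne 0$, let $\bar P_1(\theta)=A_1^1\sin\theta-B_1^1\cos\theta$, and let $P_{2m+1}(\theta)$ be a homogeneous polynomial of degree $2m+1$ with real coefficients in $\cos\theta$ and $\sin\theta$. Then $r=0$ is a center of the equation $$\frac{dr}{d\theta}=r\left(P_1(\theta)\,r+P_{2m+1}(\theta)\,r^{2m+1}\right)$$ if and only if $$\int_0^{2\pi}\bar P_1(\theta)^{2j+1}\,P_{2m+1}(\theta)\,d\theta=0\qquad (j=0,1,2,\dots,m).$$
   Context: For a scalar differential equation $\frac{dr}{d\theta}=F(\theta,r)$ with $F$ $2\pi$-periodic in $\theta$ and $F(\theta,0)\equiv 0$, we say that $r=0$ is a center if all solutions $r(\theta)$ close to the solution $r\equiv 0$ are $2\pi$-periodic, i.e. satisfy $r(2\pi)=r(0)$. *)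

(* Defs.v *)
From Stdlib Require Import Reals.
From Coquelicot Require Import Coquelicot.
Open Scope R_scope.

(* A value of [r] outside [0, 2 PI] is irrelevant except for the two-sided
   derivatives at the endpoints: every solution on [0, 2 PI] with one-sided
   endpoint derivatives extends (affinely) to such an [r]. *)
Definition is_solution (F : R -> R -> R) (r : R -> R) : Prop :=
  forall t : R, 0 <= t <= 2 * PI -> is_derive r t (F t (r t)).

(* Solutions are close to [r = 0] in the sense of their initial values, and are
   only required to live on one period: a solution with small initial value
   need not exist for all times when [r = 0] is not a center. *)
Definition is_center (F : R -> R -> R) : Prop :=
  exists delta : R, 0 < delta /\
    forall r : R -> R,
      is_solution F r -> Rabs (r 0) < delta -> r (2 * PI) = r 0.

(* As usual, the zero polynomial is homogeneous of every degree. *)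
Definition trig_homogeneous (n : nat) (P : R -> R) : Prop :=
  exists c : nat -> R, forall t : R,
    P t = sum_f_R0 (fun k => c k * cos t ^ (n - k) * sin t ^ k) n.

Definition P1 (A B t : R) : R := A * cos t + B * sin t.

Definition P1bar (A B t : R) : R := A * sin t - B * cos t.

(* Main.v *)
Require Import Defs.
From Stdlib Require Import Reals Lra Lia Psatz.
From Coquelicot Require Import Coquelicot.
Open Scope R_scope.

(* Write b for the primitive P1bar of P1 and q for P.

   Center => moments: for a small positive solution r put z = r / (1 + r b), so
   that 1 + r b = 1 / (1 - b z) and z' = q (1 + r b)^(2m) z^(2m+2).  Hence
   q (1 + r b)^(2m) is the derivative of -1 / ((2m+1) z^(2m+1)), and its integral
   over a period vanishes if r is periodic.  As z = eps + O(eps^(2m+2)) with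
   eps = z(0), the integral of q (1 - b eps)^(-2m) is O(eps^(2m+2)).  All
   coefficients of the series of (1 - x)^(-2m) are positive, so the integrals of
   b^k q vanish for k <= 2m+1.

   Moments => center: let t0 be a zero of P1 in [0, PI].  Then b is a multiple of
   u = cos (t - t0), and q = E(u) + sin (t - t0) O(u) with E a combination of the
   odd powers u, u^3, ..., u^(2m+1).  The moment conditions say that E(u) is
   orthogonal to q; it is also orthogonal to sin (t - t0) O(u), so E(u) = 0.  Thus
   P1 and q are odd under the reflections in t0 and t0 + PI, and uniqueness of
   solutions gives r(0) = r(2 t0) = r(2 PI). *)

(** * Existence of solutions by contraction *)

Lemma mean_value_bound (f df : R -> R) (M a b : R) :
  (forall t, Rmin a b <= t <= Rmax a b -> is_derive f t (df t)) ->
  (forall t, Rmin a b <= t <= Rmax a b -> Rabs (df t) <= M) ->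
  Rabs (f b - f a) <= M * Rabs (b - a).
Proof.
intros Hd HM.
destruct (MVT_gen f a b df) as [c [Hc ->]].
- intros t Ht; apply Hd; lra.
- intros t Ht; apply derivable_continuous_pt.
  exists (df t); apply is_derive_Reals, Hd, Ht.
- rewrite Rabs_mult; apply Rmult_le_compat_r; [apply Rabs_pos|auto].
Qed.

Lemma lipschitz_continuous (f : R -> R) (M : R) :
  (forall s t, Rabs (f t - f s) <= M * Rabs (t - s)) ->
  forall t, continuous f t.
Proof.
intros H t.
apply continuity_pt_filterlim.
intros eps Heps.
assert (HM : 0 <= Rabs M) by apply Rabs_pos.
exists (eps / (Rabs M + 1)); split.
- apply Rdiv_lt_0_compat; lra.
- intros s [_ Hs].
  unfold dist in *; simpl in *; unfold Rdist in *.
  apply Rle_lt_trans with (1 := H t s).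
  apply Rle_lt_trans with ((Rabs M + 1) * Rabs (s - t)).
  + apply Rmult_le_compat_r; [apply Rabs_pos|].
    generalize (Rle_abs M); lra.
  + apply Rmult_lt_compat_l with (r := Rabs M + 1) in Hs; [|lra].
    replace ((Rabs M + 1) * (eps / (Rabs M + 1))) with eps in Hs by (field; lra).
    exact Hs.
Qed.

Lemma is_derive_RInt_continuous (f : R -> R) (a t : R) :
  (forall s, continuous f s) -> is_derive (fun x => RInt f a x) t (f t).
Proof.
intros Hf.
apply (is_derive_RInt f (fun x => RInt f a x) a t); [|apply Hf].
apply filter_forall; intros x; apply (RInt_correct f).
apply (ex_RInt_continuous (V := R_CompleteNormedModule)); intros; apply Hf.
Qed.

Lemma ex_RInt_everywhere_continuous (f : R -> R) (a b : R) :
  (forall s, continuous f s) -> ex_RInt f a b.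
Proof.
intros Hf; apply (ex_RInt_continuous (V := R_CompleteNormedModule)); intros; apply Hf.
Qed.

(** Lets the geometric error of the Picard iterates be discarded in inequalities about their
    limit. *)
Lemma le_of_le_plus_geometric (x y K : R) :
  (forall n, x <= y + K * (1 / 2) ^ n) -> x <= y.
Proof.
intros H.
apply (is_lim_seq_le (fun _ => x) (fun n => y + K * (1 / 2) ^ n) x y H).
- apply is_lim_seq_const.
- replace (Finite y) with (Finite (y + K * 0)) by (f_equal; ring).
  apply is_lim_seq_plus'; [apply is_lim_seq_const|].
  apply (is_lim_seq_scal_l (fun n => (1 / 2) ^ n) K 0).
  apply is_lim_seq_geom; rewrite Rabs_pos_eq; lra.
Qed.

(** Truncation to [-a, a], used in two ways: on time, so that the Picard iterates live on the whole
    line, and on the unknown, so that a polynomial right-hand side becomes globally bounded and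
    Lipschitz. *)
Definition clamp (a x : R) : R := Rmax (- a) (Rmin a x).

Lemma clamp_id (a x : R) : Rabs x <= a -> clamp a x = x.
Proof.
intros H; apply Rabs_le_between in H.
unfold clamp; rewrite Rmin_right, Rmax_right; lra.
Qed.

Lemma clamp_bound (a x : R) : 0 <= a -> Rabs (clamp a x) <= a.
Proof.
intros H; apply Rabs_le_between.
unfold clamp, Rmax, Rmin; repeat destruct Rle_dec; lra.
Qed.

Lemma clamp_lipschitz (a s t : R) :
  0 <= a -> Rabs (clamp a t - clamp a s) <= 1 * Rabs (t - s).
Proof.
intros H; unfold clamp, Rmax, Rmin.
repeat destruct Rle_dec; unfold Rabs; repeat destruct Rcase_abs; lra.
Qed.

Section Picard.

Variables (G : R -> R -> R) (c T M L : R).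
Hypothesis T_pos : 0 < T.
Hypothesis G_bound : forall s x, Rabs (G s x) <= M.
Hypothesis G_lipschitz : forall s x y, Rabs (G s x - G s y) <= L * Rabs (x - y).
Hypothesis LT_half : L * T <= 1 / 2.
Hypothesis L_nonneg : 0 <= L.
(** Continuity along continuous curves is exactly what makes the integrand of [step] continuous. *)
Hypothesis G_continuous : forall z : R -> R, (forall t, continuous z t) ->
  forall t, continuous (fun s => G s (z s)) t.

Let step (z : R -> R) (t : R) : R := c + RInt (fun s => G s (z s)) 0 (clamp T t).

Fixpoint picard (n : nat) : R -> R :=
  match n with O => fun _ => c | S n => step (picard n) end.

Lemma picard_bound_nonneg : 0 <= M.
Proof. apply Rle_trans with (2 := G_bound 0 0), Rabs_pos. Qed.

(** The constant [M] does not depend on [z], so all iterates after the first share it and it passes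
    to their limit. *)
Lemma step_lipschitz (z : R -> R) : (forall t, continuous z t) ->
  forall s t, Rabs (step z t - step z s) <= M * Rabs (t - s).
Proof.
intros Hz s t; unfold step.
replace (c + RInt (fun s0 => G s0 (z s0)) 0 (clamp T t) -
  (c + RInt (fun s0 => G s0 (z s0)) 0 (clamp T s))) with
  (RInt (fun s0 => G s0 (z s0)) 0 (clamp T t) -
   RInt (fun s0 => G s0 (z s0)) 0 (clamp T s)) by ring.
apply Rle_trans with (M * Rabs (clamp T t - clamp T s)).
- apply (mean_value_bound (fun x => RInt (fun s0 => G s0 (z s0)) 0 x)
    (fun s0 => G s0 (z s0))).
  + intros x _; apply (is_derive_RInt_continuous (fun s0 => G s0 (z s0))); auto.
  + intros x _; apply G_bound.
- apply Rmult_le_compat_l; [apply picard_bound_nonneg|].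
  generalize (clamp_lipschitz T s t); lra.
Qed.

(** The integrands differ by at most L d and the clamped interval has length at most T, so [LT_half]
    gives the factor 1/2. *)
Lemma step_contracts (y z : R -> R) (d : R) :
  (forall t, continuous y t) -> (forall t, continuous z t) ->
  (forall t, Rabs (z t - y t) <= d) ->
  forall t, Rabs (step z t - step y t) <= d * (1 / 2).
Proof.
intros Hy Hz Hd t.
assert (d_nonneg : 0 <= d) by (apply Rle_trans with (2 := Hd 0), Rabs_pos).
pose (h := fun x => RInt (fun s => G s (z s)) 0 x - RInt (fun s => G s (y s)) 0 x).
replace (step z t - step y t) with (h (clamp T t) - h 0)
  by (unfold h, step; rewrite !RInt_point; unfold zero; simpl; ring).
apply Rle_trans with (L * d * Rabs (clamp T t - 0)).
- apply (mean_value_bound h (fun s => G s (z s) - G s (y s))).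
  + intros x _; unfold h.
    apply (is_derive_minus (V := R_NormedModule)).
    * apply (is_derive_RInt_continuous (fun s0 => G s0 (z s0))); auto.
    * apply (is_derive_RInt_continuous (fun s0 => G s0 (y s0))); auto.
  + intros x _; apply Rle_trans with (1 := G_lipschitz _ _ _).
    apply Rmult_le_compat_l; auto.
- rewrite Rminus_0_r.
  assert (Hc := clamp_bound T t).
  assert (0 <= L * d) by (apply Rmult_le_pos; auto).
  apply Rle_trans with (L * d * T).
  + apply Rmult_le_compat_l; lra.
  + nra.
Qed.

Lemma picard_continuous (n : nat) (t : R) : continuous (picard n) t.
Proof.
revert t; induction n as [|n IH]; intros t; simpl.
- apply continuous_const.
- apply lipschitz_continuous with M, step_lipschitz, IH.
Qed.

Lemma picard_succ_close (n : nat) (t : R) :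
  Rabs (picard (S n) t - picard n t) <= M * T * (1 / 2) ^ n.
Proof.
revert t; induction n as [|n IH]; intros t.
- simpl; unfold step.
  replace (c + RInt (fun s => G s c) 0 (clamp T t) - c) with
    (step (fun _ => c) t - step (fun _ => c) 0).
  + apply Rle_trans with (M * Rabs (clamp T t - 0)).
    * unfold step; replace (clamp T 0) with 0
        by (symmetry; apply clamp_id; rewrite Rabs_R0; lra).
      rewrite RInt_point; unfold zero; simpl.
      replace (c + RInt (fun s => G s c) 0 (clamp T t) - (c + 0)) with
        (RInt (fun s => G s c) 0 (clamp T t) - RInt (fun s => G s c) 0 0)
        by (rewrite RInt_point; unfold zero; simpl; ring).
      apply (mean_value_bound (fun x => RInt (fun s0 => G s0 c) 0 x)
        (fun s0 => G s0 c)).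
      -- intros x _; apply (is_derive_RInt_continuous (fun s0 => G s0 c)).
         apply (G_continuous (fun _ => c)); intros; apply continuous_const.
      -- intros x _; apply G_bound.
    * rewrite Rminus_0_r, Rmult_1_r.
      apply Rmult_le_compat_l; [apply picard_bound_nonneg|apply clamp_bound; lra].
  + unfold step; replace (clamp T 0) with 0
      by (symmetry; apply clamp_id; rewrite Rabs_R0; lra).
    rewrite RInt_point; unfold zero; simpl; ring.
- replace (M * T * (1 / 2) ^ S n) with (M * T * (1 / 2) ^ n * (1 / 2))
    by (simpl; ring).
  apply (step_contracts (picard n) (picard (S n))); auto using picard_continuous.
Qed.

Lemma picard_close (n p : nat) (t : R) :
  Rabs (picard (n + p) t - picard n t) <= 2 * (M * T) * (1 / 2) ^ n.
Proof.
assert (HMT : 0 <= M * T) by (generalize picard_bound_nonneg; intros; apply Rmult_le_pos; lra).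
(* Keeping the subtracted geometric tail makes the induction on [p] close. *)
assert (H : Rabs (picard (n + p) t - picard n t) <=
  2 * (M * T) * ((1 / 2) ^ n - (1 / 2) ^ (n + p))).
{ induction p as [|p IH].
  - rewrite Nat.add_0_r, !Rminus_diag, Rabs_R0; lra.
  - rewrite Nat.add_succ_r.
    replace (picard (S (n + p)) t - picard n t) with
      ((picard (S (n + p)) t - picard (n + p) t) + (picard (n + p) t - picard n t))
      by ring.
    apply Rle_trans with (1 := Rabs_triang _ _).
    generalize (picard_succ_close (n + p) t).
    change ((1 / 2) ^ S (n + p)) with (1 / 2 * (1 / 2) ^ (n + p)); lra. }
assert (0 <= (1 / 2) ^ (n + p)) by (apply pow_le; lra).
nra.
Qed.

Lemma picard_cauchy (t : R) : Cauchy_crit (fun n => picard n t).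
Proof.
intros eps Heps.
assert (HMT : 0 <= M * T) by (generalize picard_bound_nonneg; intros; apply Rmult_le_pos; lra).
destruct (pow_lt_1_zero (1 / 2)) with (y := eps / (4 * (M * T) + 1)) as [N HN].
- rewrite Rabs_pos_eq; lra.
- apply Rdiv_lt_0_compat; lra.
- exists N; intros n p Hn Hp.
  assert (HN' := HN N (le_n N)).
  assert (0 <= (1 / 2) ^ N) by (apply pow_le; lra).
  rewrite Rabs_pos_eq in HN' by auto.
  apply Rmult_lt_compat_r with (r := 4 * (M * T) + 1) in HN'; [|lra].
  replace (eps / (4 * (M * T) + 1) * (4 * (M * T) + 1)) with eps in HN'
    by (field; lra).
  assert (H1 := picard_close N (n - N) t).
  assert (H2 := picard_close N (p - N) t).
  replace (N + (n - N))%nat with n in H1 by lia.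
  replace (N + (p - N))%nat with p in H2 by lia.
  unfold Rdist.
  replace (picard n t - picard p t) with
    ((picard n t - picard N t) - (picard p t - picard N t)) by ring.
  apply Rle_lt_trans with (1 := Rabs_triang _ _).
  rewrite Rabs_Ropp; lra.
Qed.

(** The iterates converge geometrically; the limit is a fixed point of [step], and differentiating
    the integral gives the equation. The time interval is symmetric about 0, so the derivative at 0
    is two-sided. *)
Lemma picard_exists : exists z : R -> R,
  z 0 = c /\ forall t, Rabs t < T -> is_derive z t (G t (z t)).
Proof.
pose (z := fun t => proj1_sig (Rcomplete.R_complete _ (picard_cauchy t))).
assert (Hlim : forall t, is_lim_seq (fun n => picard n t) (z t)).
{ intros t; apply is_lim_seq_Reals; unfold z; destruct Rcomplete.R_complete; auto. }
assert (Hclose : forall n t, Rabs (z t - picard n t) <= 2 * (M * T) * (1 / 2) ^ n).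
{ intros n t.
  apply (is_lim_seq_le (fun p => Rabs (picard (n + p) t - picard n t))
    (fun _ => 2 * (M * T) * (1 / 2) ^ n)
    (Rabs (z t - picard n t)) (2 * (M * T) * (1 / 2) ^ n)).
  - intros p; apply picard_close.
  - apply (is_lim_seq_abs _ (z t - picard n t)).
    apply is_lim_seq_minus'; [|apply is_lim_seq_const].
    apply (is_lim_seq_ext (fun p => picard (p + n) t)).
    + intros p; now rewrite Nat.add_comm.
    + apply (is_lim_seq_incr_n (fun p => picard p t)), Hlim.
  - apply is_lim_seq_const. }
assert (Hz : forall t, continuous z t).
{ apply lipschitz_continuous with M; intros s t.
  apply le_of_le_plus_geometric with (2 * (2 * (M * T))); intros n.
  assert (H1 := Hclose (S n) t); assert (H2 := Hclose (S n) s).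
  assert (H3 := step_lipschitz (picard n) (picard_continuous n) s t).
  change (step (picard n)) with (picard (S n)) in H3.
  replace (z t - z s) with ((z t - picard (S n) t) +
    ((picard (S n) t - picard (S n) s) - (z s - picard (S n) s))) by ring.
  apply Rle_trans with (1 := Rabs_triang _ _).
  assert (H4 := Rabs_triang (picard (S n) t - picard (S n) s)
    (- (z s - picard (S n) s))).
  rewrite Rabs_Ropp in H4.
  change ((1 / 2) ^ S n) with (1 / 2 * (1 / 2) ^ n) in *.
  assert (0 <= (1 / 2) ^ n) by (apply pow_le; lra).
  assert (0 <= M * T) by (generalize picard_bound_nonneg; intros; apply Rmult_le_pos; lra).
  assert (0 <= M * T * (1 / 2) ^ n) by (apply Rmult_le_pos; lra).
  unfold Rminus in *; lra. }
(* Both sides lie within a geometric distance of [picard (S n)]. *)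
assert (Hfix : forall t, z t = step z t).
{ intros t; apply Rminus_diag_uniq, Rabs_eq_0.
  apply Rle_antisym; [|apply Rabs_pos].
  apply le_of_le_plus_geometric with (2 * (M * T)); intros n.
  assert (H1 := Hclose (S n) t).
  assert (H2 := step_contracts (picard n) z _ (picard_continuous n) Hz (Hclose n) t).
  change (step (picard n)) with (picard (S n)) in H2.
  replace (z t - step z t) with
    ((z t - picard (S n) t) - (step z t - picard (S n) t)) by ring.
  apply Rle_trans with (1 := Rabs_triang _ _).
  rewrite Rabs_Ropp.
  change ((1 / 2) ^ S n) with (1 / 2 * (1 / 2) ^ n) in *; lra. }
exists z; split.
- rewrite Hfix; unfold step.
  rewrite clamp_id by (rewrite Rabs_R0; lra).
  rewrite RInt_point; unfold zero; simpl; ring.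
- intros t Ht.
  (* Near an interior time the clamp is inactive, so [z] coincides there with a plain integral. *)
  apply (is_derive_ext_loc (fun x => c + RInt (fun s => G s (z s)) 0 x)).
  + assert (Hpos : 0 < T - Rabs t) by lra.
    exists (mkposreal _ Hpos); intros x Hx.
    unfold ball in Hx; simpl in Hx; unfold AbsRing_ball, abs, minus, plus, opp in Hx;
      simpl in Hx.
    rewrite (Hfix x); unfold step; rewrite clamp_id; auto.
    replace x with ((x + - t) + t) by ring.
    generalize (Rabs_triang (x + - t) t); lra.
  + replace (G t (z t)) with (0 + G t (z t)) by ring.
    apply (is_derive_plus (V := R_NormedModule));
      [apply (is_derive_const (V := R_NormedModule))|].
    apply (is_derive_RInt_continuous (fun s => G s (z s))); auto.
Qed.

End Picard.

(** * Small solutions over one period *)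

Lemma pow_lipschitz (M x y : R) (n : nat) : Rabs x <= M -> Rabs y <= M ->
  Rabs (x ^ n - y ^ n) <= INR n * M ^ pred n * Rabs (x - y).
Proof.
intros Hx Hy.
assert (HM : 0 <= M) by (apply Rle_trans with (2 := Hx), Rabs_pos).
replace (x ^ n - y ^ n) with ((fun t => t ^ n) x - (fun t => t ^ n) y) by auto.
apply (mean_value_bound (fun t => t ^ n) (fun t => INR n * t ^ pred n)).
- intros t _; apply is_derive_Reals, derivable_pt_lim_pow.
- intros t Ht.
  rewrite Rabs_mult, (Rabs_pos_eq (INR n)) by apply pos_INR.
  apply Rmult_le_compat_l; [apply pos_INR|].
  rewrite <- RPow_abs; apply pow_incr; split; [apply Rabs_pos|].
  apply Rabs_le_between in Hx; apply Rabs_le_between in Hy.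
  apply Rabs_le_between.
  revert Ht; unfold Rmin, Rmax; destruct Rle_dec; lra.
Qed.

(** The right-hand side is p x^2 + q x^(n+1), to which [pow_lipschitz] applies term by term. The
    estimate serves both existence and, through Gronwall, uniqueness. *)
Lemma rhs_lipschitz (D M p q x y : R) (n : nat) :
  Rabs p <= D -> Rabs q <= D -> Rabs x <= M -> Rabs y <= M ->
  Rabs (x * (p * x + q * x ^ n) - y * (p * y + q * y ^ n)) <=
  D * (2 * M + INR (S n) * M ^ n) * Rabs (x - y).
Proof.
intros Hp Hq Hx Hy.
replace (x * (p * x + q * x ^ n) - y * (p * y + q * y ^ n)) with
  (p * (x ^ 2 - y ^ 2) + q * (x ^ S n - y ^ S n)) by (simpl; ring).
apply Rle_trans with (1 := Rabs_triang _ _).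
rewrite !Rabs_mult.
replace (D * (2 * M + INR (S n) * M ^ n) * Rabs (x - y)) with
  (D * (INR 2 * M ^ pred 2 * Rabs (x - y)) +
   D * (INR (S n) * M ^ pred (S n) * Rabs (x - y))) by (simpl; ring).
apply Rplus_le_compat; apply Rmult_le_compat; auto using Rabs_pos, pow_lipschitz.
Qed.

(** The right-hand side is at least quadratic in r, so its Lipschitz constant at scale c is O(c),
    and for small c a single contraction covers the whole period. The bound on [D * c0] later keeps
    r b away from -1. *)
Lemma small_solution_exists (D : R) (p q : R -> R) (n : nat) :
  (1 <= n)%nat -> 1 <= D ->
  (forall t, continuous p t) -> (forall t, continuous q t) ->
  (forall t, Rabs (p t) <= D) -> (forall t, Rabs (q t) <= D) ->
  exists c0, 0 < c0 /\ 72 * D * c0 <= 1 /\ forall c, 0 < c <= c0 ->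
  exists r : R -> R, r 0 = c /\
    (forall t, 0 <= t <= 2 * PI ->
       is_derive r t (r t * (p t * r t + q t * r t ^ n))) /\
    (forall t, 0 <= t <= 2 * PI -> c / 2 <= r t <= 2 * c).
Proof.
intros Hn HD Hpc Hqc Hp Hq.
(* The 3 + n collects 2 from the quadratic term and n + 1 from the term of degree n + 1. *)
pose (C := D * (INR n + 3)).
assert (HC : D <= C).
{ unfold C; generalize (pos_INR n); nra. }
(* With M = 2 c, this makes the contraction constant 9 C M at most 1/4 and the drift over a period,
   at most 32 C c^2, less than c / 2. *)
exists (/ (72 * C)); split; [|split].
- apply Rinv_0_lt_compat; lra.
- apply Rmult_le_reg_r with C; [lra|].
  replace (72 * D * / (72 * C) * C) with D by (field; lra); lra.
- intros c [Hc Hc'].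
  assert (HcC : 72 * C * c <= 1).
  { apply Rmult_le_compat_l with (r := 72 * C) in Hc'; [|lra].
    rewrite Rinv_r in Hc'; lra. }
  pose (F := fun t r => r * (p t * r + q t * r ^ n)).
  pose (M := 2 * c).
  assert (HM : 0 <= M <= 1) by (unfold M; split; nra).
  assert (HF : forall t x y, Rabs x <= M -> Rabs y <= M ->
    Rabs (F t x - F t y) <= C * M * Rabs (x - y)).
  { intros t x y Hx Hy.
    apply Rle_trans with (1 := rhs_lipschitz D M _ _ x y n (Hp t) (Hq t) Hx Hy).
    apply Rmult_le_compat_r; [apply Rabs_pos|].
    assert (M ^ n <= M).
    { destruct n as [|n]; [lia|simpl].
      rewrite <- (Rmult_1_r M) at 3.
      apply Rmult_le_compat_l; [lra|].
      rewrite <- (pow1 n); apply pow_incr; lra. }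
    unfold C; rewrite S_INR.
    replace (D * (INR n + 3) * M) with (D * (2 * M + (INR n + 1) * M)) by ring.
    apply Rmult_le_compat_l; [lra|].
    apply Rplus_le_compat_l, Rmult_le_compat_l; [|auto].
    generalize (pos_INR n); lra. }
  (* The time 9 exceeds 2 PI, so the derivative at 2 PI is two-sided as well. *)
  destruct (picard_exists (fun t x => F t (clamp M x)) c 9 (C * M * M) (C * M))
    as [r [Hr0 Hr]].
  + lra.
  + intros s x.
    replace (F s (clamp M x)) with (F s (clamp M x) - F s 0) by (unfold F; ring).
    assert (Hcl := clamp_bound M x (proj1 HM)).
    apply Rle_trans with (1 := HF s (clamp M x) 0 Hcl ltac:(rewrite Rabs_R0; lra)).
    rewrite Rminus_0_r; apply Rmult_le_compat_l; [|lra]; nra.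
  + intros s x y.
    apply Rle_trans with (1 := HF s _ _ (clamp_bound M x (proj1 HM))
      (clamp_bound M y (proj1 HM))).
    apply Rmult_le_compat_l; [nra|].
    generalize (clamp_lipschitz M y x (proj1 HM)); lra.
  + unfold M; lra.
  + nra.
  + intros z Hz t.
    assert (Hcl : continuous (fun s => clamp M (z s)) t).
    { apply continuous_comp; [apply Hz|].
      apply lipschitz_continuous with 1; intros; apply clamp_lipschitz, HM. }
    unfold F.
    assert (Hpow : continuous (fun s => clamp M (z s) ^ n) t).
    { apply (continuous_comp (fun s => clamp M (z s)) (fun x => x ^ n)); auto.
      apply (ex_derive_continuous (fun x : R => x ^ n)).
      auto_derive; auto. }
    apply (continuous_mult (K := R_AbsRing) _ _ _ Hcl).
    apply (continuous_plus (V := R_NormedModule)).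
    * apply (continuous_mult (K := R_AbsRing)); auto.
    * apply (continuous_mult (K := R_AbsRing)); auto.
  + assert (HPI : 2 * PI <= 8) by (generalize PI_4; lra).
    (* The truncated solution stays below the truncation level M = 2 c, hence solves the original
       equation. *)
    assert (Hb : forall t, 0 <= t <= 2 * PI -> c / 2 <= r t <= 3 / 2 * c).
    { intros t Ht.
      assert (Hd : Rabs (r t - r 0) <= C * M * M * Rabs (t - 0)).
      { apply (mean_value_bound r (fun t => F t (clamp M (r t)))).
        - intros s Hs; apply Hr; apply Rabs_lt_between.
          rewrite Rmin_left, Rmax_right in Hs; lra.
        - intros s _.
          replace (F s (clamp M (r s))) with (F s (clamp M (r s)) - F s 0)
            by (unfold F; ring).
          assert (Hcl := clamp_bound M (r s) (proj1 HM)).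
          apply Rle_trans with
            (1 := HF s (clamp M (r s)) 0 Hcl ltac:(rewrite Rabs_R0; lra)).
          rewrite Rminus_0_r; apply Rmult_le_compat_l; [|lra]; nra. }
      rewrite Hr0, Rminus_0_r, (Rabs_pos_eq t) in Hd by lra.
      assert (C * M * M * t <= 32 * C * c * c).
      { apply Rle_trans with (C * M * M * 8); [|unfold M; lra].
        apply Rmult_le_compat_l; [|lra].
        apply Rmult_le_pos; [apply Rmult_le_pos|]; lra. }
      assert (32 * C * c * c <= c / 2) by nra.
      apply Rabs_le_between in Hd; lra. }
    exists r; split; [auto|split].
    * intros t Ht; change (is_derive r t (F t (r t))).
      rewrite <- (clamp_id M (r t)).
      -- apply Hr; apply Rabs_lt_between; lra.
      -- assert (Hb' := Hb t Ht); unfold M; apply Rabs_le_between; lra.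
    * intros t Ht; assert (Hb' := Hb t Ht); lra.
Qed.

(** * Expansion of (1 - x)^(-n) and vanishing of coefficients *)

(** The coefficient of x^k in (1 - x)^(-n): multiplying a series by 1 / (1 - x) replaces its
    coefficients by their partial sums. This form makes positivity immediate. *)
Fixpoint inv_pow_coeff (n k : nat) : R :=
  match n with
  | O => match k with O => 1 | S _ => 0 end
  | S n => sum_f_R0 (inv_pow_coeff n) k
  end.

Lemma inv_pow_coeff_nonneg (n k : nat) : 0 <= inv_pow_coeff n k.
Proof.
revert k; induction n as [|n IH]; intros k; simpl.
- destruct k; lra.
- apply cond_pos_sum, IH.
Qed.

Lemma inv_pow_coeff_pos (n k : nat) : 0 < inv_pow_coeff (S n) k.
Proof.
assert (H0 : forall j, inv_pow_coeff j 0 = 1) by (induction j; simpl; auto).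
simpl; induction k as [|k IH]; simpl.
- rewrite H0; lra.
- generalize (inv_pow_coeff_nonneg n (S k)); lra.
Qed.

(** Finite form of the recursion on coefficients; the last term is the truncation error it
    introduces. *)
Lemma inv_pow_coeff_telescope (n N : nat) (x : R) :
  (1 - x) * sum_f_R0 (fun k => inv_pow_coeff (S n) k * x ^ k) N =
  sum_f_R0 (fun k => inv_pow_coeff n k * x ^ k) N - inv_pow_coeff (S n) N * x ^ S N.
Proof.
induction N as [|N IH].
- simpl; ring.
- rewrite !tech5, Rmult_plus_distr_l, IH.
  change (inv_pow_coeff (S n) (S N)) with
    (inv_pow_coeff (S n) N + inv_pow_coeff n (S N)).
  simpl; ring.
Qed.

(** By induction on [n]: each division by 1 - x at most doubles the error, since |x| <= 1/2, and
    adds the remainder of the telescoping identity. *)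
Lemma inv_pow_expansion (n N : nat) : exists K, 0 <= K /\
  forall x, Rabs x <= 1 / 2 ->
  Rabs ((/ (1 - x)) ^ n - sum_f_R0 (fun k => inv_pow_coeff n k * x ^ k) N) <=
  K * Rabs x ^ S N.
Proof.
induction n as [|n [K [HK IH]]].
- exists 0; split; [lra|]; intros x _.
  replace (sum_f_R0 (fun k => inv_pow_coeff 0 k * x ^ k) N) with 1.
  + rewrite Rminus_diag, Rabs_R0; lra.
  + induction N as [|N IH]; simpl in *; [|rewrite <- IH]; ring.
- exists (2 * (K + inv_pow_coeff (S n) N)).
  assert (Hb := inv_pow_coeff_nonneg (S n) N).
  split; [lra|]; intros x Hx.
  assert (Hx' := Hx); apply Rabs_le_between in Hx'.
  assert (IHx := IH x Hx).
  replace ((/ (1 - x)) ^ S n -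
    sum_f_R0 (fun k => inv_pow_coeff (S n) k * x ^ k) N) with
    (/ (1 - x) * (((/ (1 - x)) ^ n - sum_f_R0 (fun k => inv_pow_coeff n k * x ^ k) N)
       + inv_pow_coeff (S n) N * x ^ S N)).
  + rewrite Rabs_mult, Rmult_assoc.
    apply Rmult_le_compat; try apply Rabs_pos.
    * rewrite Rabs_pos_eq.
      -- rewrite <- (Rinv_inv 2); apply Rinv_le_contravar; lra.
      -- left; apply Rinv_0_lt_compat; lra.
    * apply Rle_trans with (1 := Rabs_triang _ _).
      rewrite Rmult_plus_distr_r; apply Rplus_le_compat; auto.
      rewrite Rabs_mult, <- RPow_abs, (Rabs_pos_eq (inv_pow_coeff _ _)); auto; lra.
  + assert (Ht := inv_pow_coeff_telescope n N x).
    apply Rmult_eq_reg_l with (1 - x); [|lra].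
    rewrite Rmult_minus_distr_l, Ht.
    change ((/ (1 - x)) ^ S n) with (/ (1 - x) * (/ (1 - x)) ^ n).
    field; lra.
Qed.

Lemma sum_pow_bound (N : nat) (d e : nat -> R) :
  (forall k, Rabs (e k) <= 1) ->
  Rabs (sum_f_R0 (fun k => d k * e k) N) <= sum_f_R0 (fun k => Rabs (d k)) N.
Proof.
intros He.
apply Rle_trans with (1 := Rsum_abs _ _).
apply sum_Rle; intros k _; rewrite Rabs_mult.
rewrite <- (Rmult_1_r (Rabs (d k))) at 2.
apply Rmult_le_compat_l; [apply Rabs_pos|auto].
Qed.

Lemma zero_of_le_linear (d K delta : R) :
  0 < delta -> (forall x, 0 < x < delta -> Rabs d <= K * x) -> d = 0.
Proof.
intros Hdelta H.
apply Rabs_eq_0, Rle_antisym; [|apply Rabs_pos].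
apply le_epsilon; intros eps Heps; rewrite Rplus_0_l.
assert (HK : 0 <= Rabs K) by apply Rabs_pos.
pose (x := Rmin (delta / 2) (eps / (Rabs K + 1))).
assert (Hx : 0 < x).
{ apply Rmin_pos; [lra|apply Rdiv_lt_0_compat; lra]. }
assert (Hx1 : x <= delta / 2) by apply Rmin_l.
assert (Hx2 : x <= eps / (Rabs K + 1)) by apply Rmin_r.
assert (Hb := H x ltac:(lra)).
apply Rmult_le_compat_l with (r := Rabs K + 1) in Hx2; [|lra].
replace ((Rabs K + 1) * (eps / (Rabs K + 1))) with eps in Hx2 by (field; lra).
generalize (Rle_abs K); nra.
Qed.

(** Letting x tend to 0 kills the constant coefficient; dividing by x then reduces the degree and
    the order of the bound together. *)
Lemma poly_coeffs_zero (N : nat) (d : nat -> R) (K delta : R) :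
  0 < delta ->
  (forall x, 0 < x < delta ->
     Rabs (sum_f_R0 (fun k => d k * x ^ k) N) <= K * x ^ S N) ->
  forall k, (k <= N)%nat -> d k = 0.
Proof.
revert d; induction N as [|N IH]; intros d Hdelta H.
- intros k Hk; replace k with O by lia.
  apply (zero_of_le_linear _ K delta Hdelta); intros x Hx.
  generalize (H x Hx); simpl; rewrite !Rmult_1_r; auto.
- assert (Hsplit : forall x, sum_f_R0 (fun k => d k * x ^ k) (S N) =
    d O + x * sum_f_R0 (fun k => d (S k) * x ^ k) N).
  { intros x; rewrite decomp_sum by lia; simpl pred.
    rewrite scal_sum; simpl; f_equal; [ring|].
    apply sum_eq; intros; ring. }
  assert (H0 : d O = 0).
  { pose (G := sum_f_R0 (fun k => Rabs (d (S k))) N).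
    apply (zero_of_le_linear _ (Rabs K + G) (Rmin delta 1)).
    { apply Rmin_pos; lra. }
    intros x Hx.
    assert (Hx1 : x < delta) by (generalize (Rmin_l delta 1); lra).
    assert (Hx2 : x < 1) by (generalize (Rmin_r delta 1); lra).
    assert (Hpow : forall k, 0 <= x ^ k <= 1).
    { intros k; split; [apply pow_le; lra|].
      rewrite <- (pow1 k); apply pow_incr; lra. }
    assert (Hg := sum_pow_bound N (fun k => d (S k)) (fun k => x ^ k)).
    assert (Hb := H x ltac:(lra)); rewrite Hsplit in Hb.
    set (g := sum_f_R0 (fun k => d (S k) * x ^ k) N) in *.
    assert (Hg' : Rabs g <= G).
    { apply Hg; intros k; rewrite Rabs_pos_eq; apply Hpow. }
    replace (d O) with ((d O + x * g) - x * g) by ring.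
    apply Rle_trans with (1 := Rabs_triang _ _).
    rewrite Rabs_Ropp, Rabs_mult, (Rabs_pos_eq x) by lra.
    assert (K * x ^ S (S N) <= Rabs K * x).
    { apply Rle_trans with (Rabs K * x ^ S (S N)).
      - apply Rmult_le_compat_r; [apply Hpow|apply Rle_abs].
      - apply Rmult_le_compat_l; [apply Rabs_pos|].
        change (x ^ S (S N)) with (x * x ^ S N).
        generalize (Hpow (S N)); nra. }
    nra. }
  assert (HS : forall k, (k <= N)%nat -> d (S k) = 0).
  { apply (IH (fun k => d (S k)) Hdelta).
    intros x Hx; assert (Hb := H x Hx).
    rewrite Hsplit, H0, Rplus_0_l, Rabs_mult, (Rabs_pos_eq x) in Hb by lra.
    apply Rmult_le_reg_l with x; [lra|].
    simpl in *; lra. }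
  intros [|k] Hk; auto; apply HS; lia.
Qed.

(** The exact part [g] has a primitive [w] with equal end values, so it contributes nothing; the
    mean value bound is applied to the primitive of [f] minus [w]. *)
Lemma near_exact_integral_bound (f g w : R -> R) (K b : R) :
  0 <= b -> (forall t, continuous f t) ->
  (forall t, 0 <= t <= b -> is_derive w t (g t)) -> w b = w 0 ->
  (forall t, 0 <= t <= b -> Rabs (f t - g t) <= K) ->
  Rabs (RInt f 0 b) <= K * b.
Proof.
intros Hb Hf Hw Hwb HK.
replace (RInt f 0 b) with ((RInt f 0 b - w b) - (RInt f 0 0 - w 0))
  by (rewrite RInt_point, Hwb; unfold zero; simpl; ring).
rewrite <- (Rabs_pos_eq b Hb) at 3.
rewrite <- (Rminus_0_r b) at 3.
apply (mean_value_bound (fun t => RInt f 0 t - w t) (fun t => f t - g t));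
  rewrite Rmin_left, Rmax_right by lra; auto.
intros t Ht; apply (is_derive_minus (V := R_NormedModule)); auto.
apply (is_derive_RInt_continuous f); auto.
Qed.

Lemma RInt_sum (f : nat -> R -> R) (d : nat -> R) (a b : R) (N : nat) :
  (forall k, ex_RInt (f k) a b) ->
  is_RInt (fun t => sum_f_R0 (fun k => d k * f k t) N) a b
    (sum_f_R0 (fun k => d k * RInt (f k) a b) N).
Proof.
intros Hf.
assert (H : forall k, is_RInt (fun t => d k * f k t) a b (d k * RInt (f k) a b)).
{ intros k; apply (is_RInt_scal (V := R_NormedModule) (f k)).
  apply (RInt_correct (f k)); auto. }
induction N as [|N IH]; simpl; [apply H|].
apply (is_RInt_plus (V := R_NormedModule)); auto.
Qed.

(** * Moments of a center *)

Lemma continuous_pow (f : R -> R) (n : nat) (t : R) :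
  continuous f t -> continuous (fun s => f s ^ n) t.
Proof.
intros Hf; apply (continuous_comp f (fun x => x ^ n)); auto.
apply (ex_derive_continuous (fun x : R => x ^ n)); auto_derive; auto.
Qed.

Section CenterMoments.

Variables (m : nat) (D : R) (p b q : R -> R).
Hypothesis m_pos : (1 <= m)%nat.
Hypothesis D_ge_1 : 1 <= D.
Hypothesis p_continuous : forall t, continuous p t.
Hypothesis q_continuous : forall t, continuous q t.
Hypothesis b_derive : forall t, is_derive b t (p t).
Hypothesis b_periodic : b (2 * PI) = b 0.
Hypothesis p_bound : forall t, Rabs (p t) <= D.
Hypothesis b_bound : forall t, Rabs (b t) <= D.
Hypothesis q_bound : forall t, Rabs (q t) <= D.

(* The substitution z = r / (1 + r b) turns the equation into
   z' = q r^(2m) z^2 = q (1 + r b)^(2m) z^(2m+2). *)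
Lemma substitution_derive (r : R -> R) (t : R) :
  is_derive r t (r t * (p t * r t + q t * r t ^ (2 * m + 1))) ->
  1 + r t * b t <> 0 ->
  is_derive (fun s => r s / (1 + r s * b s)) t
    (q t * (1 + r t * b t) ^ (2 * m) * (r t / (1 + r t * b t)) ^ (2 * m + 2)).
Proof.
intros Hr Hne.
assert (Hb := b_derive t).
auto_derive.
- repeat split; try (eexists; eassumption); auto.
- replace (Derive (fun x => r x) t) with (r t * (p t * r t + q t * r t ^ (2 * m + 1)))
    by (symmetry; apply is_derive_unique, Hr).
  replace (Derive (fun x => b x) t) with (p t)
    by (symmetry; apply is_derive_unique, Hb).
  unfold Rdiv; rewrite Rpow_mult_distr, !pow_add, pow_inv.
  field; split; auto; apply pow_nonzero; auto.
Qed.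

(** Separation of variables in z' = v z^(n+2). *)
Lemma inverse_power_derive (z : R -> R) (n : nat) (t v : R) :
  is_derive z t (v * z t ^ (n + 2)) -> z t <> 0 ->
  is_derive (fun s => - / (INR (n + 1) * z s ^ (n + 1))) t v.
Proof.
intros Hz Hne.
assert (HS : INR (n + 1) <> 0) by (apply not_0_INR; lia).
assert (Hpow : forall k, z t ^ k <> 0) by (intros; apply pow_nonzero; auto).
auto_derive.
- split; [eexists; eassumption|split; auto].
- replace (Derive (fun x => z x) t) with (v * z t ^ (n + 2))
    by (symmetry; apply is_derive_unique, Hz).
  replace (pred (n + 1)) with n by lia.
  rewrite !pow_add; simpl; field; auto.
Qed.

Lemma center_moments_sum_bound :
  is_center (fun t r => r * (p t * r + q t * r ^ (2 * m + 1))) ->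
  exists K delta, 0 < delta /\ forall eps, 0 < eps < delta ->
  Rabs (sum_f_R0 (fun k => inv_pow_coeff (2 * m) k *
      RInt (fun t => b t ^ k * q t) 0 (2 * PI) * eps ^ k) (2 * m + 1)) <=
  K * eps ^ (2 * m + 2).
Proof.
intros [dc [Hdc Hcenter]].
destruct (small_solution_exists D p q (2 * m + 1)) as [c0 [Hc0 [HDc0 Hsol]]];
  auto; [lia|].
destruct (inv_pow_expansion (2 * m) (2 * m + 1)) as [K0 [HK0 Hexp]].
pose (N := (2 * m + 2)%nat).
(* Lipschitz constant of y^(2m) for |y| <= 2, times 4 D, times the constant in |z - eps| =
   O(eps^N). *)
pose (K1 := INR (2 * m) * 2 ^ pred (2 * m) * (4 * D * (D * 2 ^ (2 * m) * 6 ^ N * 8))).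
exists (D * (K0 * D ^ N + K1) * (2 * PI)), (Rmin (c0 / 2) (dc / 2)); split.
{ apply Rmin_pos; lra. }
intros eps [Heps Heps'].
assert (He1 : eps < c0 / 2) by (generalize (Rmin_l (c0 / 2) (dc / 2)); lra).
assert (He2 : eps < dc / 2) by (generalize (Rmin_r (c0 / 2) (dc / 2)); lra).
assert (HPI : 0 < 2 * PI <= 8) by (generalize PI_4 PI_RGT_0; lra).
assert (HDe : D * eps <= 1 / 144) by nra.
(* The range up to 6 eps covers both eps and r, which is at most 2 c <= 4 eps. *)
assert (Hbe : forall t x, 0 <= x <= 6 * eps -> Rabs (x * b t) <= 1 / 24).
{ intros t x Hx; rewrite Rabs_mult, (Rabs_pos_eq x) by lra.
  apply Rle_trans with (6 * eps * D); [|lra].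
  apply Rmult_le_compat; auto using Rabs_pos; lra. }
(* Inverts z = r / (1 + r b) at time 0, so that z starts at eps. *)
pose (c := eps / (1 - eps * b 0)).
assert (Hb0 := Hbe 0 eps ltac:(lra)); apply Rabs_le_between in Hb0.
assert (Hc : eps / 2 <= c <= 2 * eps).
{ assert (Hceq : c * (1 - eps * b 0) = eps) by (unfold c; field; lra).
  split; nra. }
destruct (Hsol c ltac:(lra)) as [r [Hr0 [Hr Hrc]]].
assert (Hr2 : r (2 * PI) = r 0).
{ apply Hcenter; [exact Hr|rewrite Hr0, Rabs_pos_eq; lra]. }
assert (Hrb : forall t, 0 <= t <= 2 * PI -> 23 / 24 <= 1 + r t * b t <= 25 / 24).
{ intros t Ht; assert (H := Hrc t Ht).
  assert (H' := Hbe t (r t) ltac:(lra)); apply Rabs_le_between in H'; lra. }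
pose (z := fun s => r s / (1 + r s * b s)).
assert (Hzr : forall t, 0 <= t <= 2 * PI -> 0 < z t <= 6 * eps).
{ intros t Ht; assert (H1 := Hrb t Ht); assert (H2 := Hrc t Ht).
  assert (Hzeq : z t * (1 + r t * b t) = r t) by (unfold z; field; lra).
  split; nra. }
assert (Hz : forall t, 0 <= t <= 2 * PI -> is_derive z t
  (q t * (1 + r t * b t) ^ (2 * m) * z t ^ (2 * m + 2))).
{ intros t Ht; apply substitution_derive; [apply Hr, Ht|].
  generalize (Hrb t Ht); lra. }
assert (Hz0 : z 0 = eps).
{ unfold z; rewrite Hr0; unfold c; field; split; lra. }
assert (Hpowq : forall t, 0 <= t <= 2 * PI -> 0 <= (1 + r t * b t) ^ (2 * m) <= 2 ^ (2 * m)).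
{ intros t Ht; assert (H := Hrb t Ht); split; [apply pow_le; lra|].
  apply pow_incr; lra. }
assert (Hclose : forall t, 0 <= t <= 2 * PI ->
  Rabs (z t - eps) <= D * 2 ^ (2 * m) * 6 ^ N * 8 * eps ^ N).
{ intros t Ht; rewrite <- Hz0 at 1.
  apply Rle_trans with (D * 2 ^ (2 * m) * (6 * eps) ^ N * Rabs (t - 0)).
  - apply (mean_value_bound z
      (fun t => q t * (1 + r t * b t) ^ (2 * m) * z t ^ (2 * m + 2)));
      rewrite Rmin_left, Rmax_right by lra; intros s Hs; [apply Hz; lra|].
    assert (H1 := Hpowq s ltac:(lra)); assert (H2 := Hzr s ltac:(lra)).
    rewrite !Rabs_mult, (Rabs_pos_eq ((1 + r s * b s) ^ (2 * m))) by lra.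
    apply Rmult_le_compat; auto using Rabs_pos.
    + apply Rmult_le_pos; [apply Rabs_pos|lra].
    + apply Rmult_le_compat; auto using Rabs_pos; lra.
    + rewrite Rabs_pos_eq by (apply pow_le; lra); apply pow_incr; lra.
  - rewrite Rpow_mult_distr, Rminus_0_r, Rabs_pos_eq by lra.
    replace (D * 2 ^ (2 * m) * 6 ^ N * 8 * eps ^ N) with
      (D * 2 ^ (2 * m) * (6 ^ N * eps ^ N) * 8) by ring.
    apply Rmult_le_compat_l; [|lra].
    repeat apply Rmult_le_pos; try (apply pow_le); lra. }
pose (Sx := fun x => sum_f_R0 (fun k => inv_pow_coeff (2 * m) k * x ^ k) (2 * m + 1)).
assert (Hint : is_RInt (fun t => q t * Sx (b t * eps)) 0 (2 * PI)
  (sum_f_R0 (fun k => inv_pow_coeff (2 * m) k *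
      RInt (fun t => b t ^ k * q t) 0 (2 * PI) * eps ^ k) (2 * m + 1))).
{ apply (is_RInt_ext (fun t => sum_f_R0 (fun k =>
    (inv_pow_coeff (2 * m) k * eps ^ k) * (b t ^ k * q t)) (2 * m + 1))).
  - intros t _; unfold Sx; rewrite scal_sum; apply sum_eq; intros k _.
    rewrite Rpow_mult_distr; ring.
  - replace (sum_f_R0 _ _) with (sum_f_R0 (fun k => (inv_pow_coeff (2 * m) k * eps ^ k) *
      RInt (fun t => b t ^ k * q t) 0 (2 * PI)) (2 * m + 1))
      by (apply sum_eq; intros; ring).
    apply (RInt_sum (fun k t => b t ^ k * q t)
      (fun k => inv_pow_coeff (2 * m) k * eps ^ k)).
    intros k; apply ex_RInt_everywhere_continuous; intros s.
    apply (continuous_mult (K := R_AbsRing)); auto.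
    apply continuous_pow, (ex_derive_continuous b); eexists; apply b_derive. }
rewrite <- (is_RInt_unique _ _ _ _ Hint).
replace (D * (K0 * D ^ N + K1) * (2 * PI) * eps ^ (2 * m + 2)) with
  (D * (K0 * D ^ N + K1) * eps ^ N * (2 * PI)) by (unfold N; ring).
(* The truncated series is compared with q (1 + r b)^(2m), whose primitive is periodic because r and
   b are. *)
apply (near_exact_integral_bound _ (fun t => q t * (1 + r t * b t) ^ (2 * m))
  (fun s => - / (INR (2 * m + 1) * z s ^ (2 * m + 1)))).
- lra.
- intros t; apply (continuous_mult (K := R_AbsRing)); auto.
  apply (continuous_comp (fun t => b t * eps) Sx).
  + apply (continuous_mult (K := R_AbsRing)); [|apply continuous_const].
    apply (ex_derive_continuous b); eexists; apply b_derive.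
  + unfold Sx; generalize (2 * m + 1)%nat as n; intros n.
    induction n as [|n IH]; simpl.
    * apply (continuous_const (U := R_UniformSpace)).
    * apply (continuous_plus (V := R_NormedModule)); auto.
      apply (continuous_mult (K := R_AbsRing)); [apply continuous_const|].
      apply (continuous_pow (fun x => x) (S n)), continuous_id.
- intros t Ht; apply inverse_power_derive; [apply Hz, Ht|].
  generalize (Hzr t Ht); lra.
- unfold z; rewrite Hr2, b_periodic; auto.
- intros t Ht.
  assert (H1 := Hrb t Ht); assert (H2 := Hzr t Ht); assert (H3 := Hclose t Ht).
  assert (Hbt := Hbe t eps ltac:(lra)); rewrite (Rmult_comm eps) in Hbt.
  assert (Hbt' := Hbt); apply Rabs_le_between in Hbt'.
  set (x := b t * eps) in *.
  rewrite <- Rmult_minus_distr_l, Rabs_mult, Rmult_assoc.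
  apply Rmult_le_compat; auto using Rabs_pos.
  (* Two errors of order eps^N: replacing z by eps, and truncating the series. *)
  replace (Sx x - (1 + r t * b t) ^ (2 * m)) with
    (((/ (1 - x)) ^ (2 * m) - (1 + r t * b t) ^ (2 * m)) -
     ((/ (1 - x)) ^ (2 * m) - Sx x)) by ring.
  apply Rle_trans with (1 := Rabs_triang _ _).
  rewrite Rabs_Ropp, Rplus_comm, Rmult_plus_distr_r.
  apply Rplus_le_compat.
  + apply Rle_trans with (1 := Hexp x ltac:(lra)).
    replace (S (2 * m + 1)) with N by (unfold N; lia).
    rewrite Rmult_assoc; apply Rmult_le_compat_l; auto.
    rewrite <- Rpow_mult_distr; apply pow_incr; split; [apply Rabs_pos|].
    unfold x; rewrite Rabs_mult, (Rabs_pos_eq eps) by lra.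
    apply Rmult_le_compat_r; auto; lra.
  + assert (Hinv : 0 < / (1 - x) <= 2).
    { split; [apply Rinv_0_lt_compat; lra|].
      rewrite <- (Rinv_inv 2); apply Rinv_le_contravar; lra. }
    apply Rle_trans with (INR (2 * m) * 2 ^ pred (2 * m) *
      Rabs (/ (1 - x) - (1 + r t * b t))).
    * apply pow_lipschitz; rewrite Rabs_pos_eq; lra.
    * unfold K1; rewrite (Rmult_assoc _ _ (eps ^ N)).
      apply Rmult_le_compat_l.
      { apply Rmult_le_pos; [apply pos_INR|apply pow_le; lra]. }
      (* Follows from 1 + r b = 1 / (1 - b z) and x = b eps. *)
      replace (/ (1 - x) - (1 + r t * b t)) with
        (/ (1 - x) * (1 + r t * b t) * (- b t * (z t - eps)))
        by (unfold z, x; field; unfold x in Hbt'; lra).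
      rewrite !Rabs_mult, Rabs_Ropp, (Rabs_pos_eq (/ (1 - x))),
        (Rabs_pos_eq (1 + r t * b t)) by lra.
      replace (4 * D * (D * 2 ^ (2 * m) * 6 ^ N * 8) * eps ^ N) with
        (2 * 2 * (D * (D * 2 ^ (2 * m) * 6 ^ N * 8 * eps ^ N))) by ring.
      apply Rmult_le_compat.
      -- apply Rmult_le_pos; lra.
      -- apply Rmult_le_pos; apply Rabs_pos.
      -- apply Rmult_le_compat; lra.
      -- apply Rmult_le_compat; auto using Rabs_pos.
Qed.

(** The bound kills every coefficient of the polynomial in eps; each is a moment times a series
    coefficient, which is positive because 2m >= 1. *)
Lemma center_moments_zero :
  is_center (fun t r => r * (p t * r + q t * r ^ (2 * m + 1))) ->
  forall k, (k <= 2 * m + 1)%nat -> RInt (fun t => b t ^ k * q t) 0 (2 * PI) = 0.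
Proof.
intros Hcenter k Hk.
destruct (center_moments_sum_bound Hcenter) as [K [delta [Hdelta H]]].
replace (2 * m + 2)%nat with (S (2 * m + 1)) in H by lia.
assert (H0 := poly_coeffs_zero _ _ _ _ Hdelta H k Hk).
apply Rmult_integral in H0; destruct H0 as [H0|H0]; auto.
replace (2 * m)%nat with (S (2 * m - 1)) in H0 by lia.
generalize (inv_pow_coeff_pos (2 * m - 1) k); lra.
Qed.

End CenterMoments.

(** * Reflection symmetry *)

(* Coquelicot states some equalities in a structure projecting to [R], which
   [ring] does not recognize. *)
Ltac ring_R :=
  lazymatch goal with |- ?x = ?y => change (@eq R x y); ring end.

(** The function w^2 exp(-2 K t) is nonnegative, nonincreasing and zero at [a]. *)
Lemma gronwall_zero (w dw : R -> R) (K a b : R) :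
  a <= b ->
  (forall t, a <= t <= b -> is_derive w t (dw t)) ->
  (forall t, a <= t <= b -> Rabs (dw t) <= K * Rabs (w t)) ->
  w a = 0 -> w b = 0.
Proof.
intros Hab Hw HK Ha.
pose (dh := fun t => (2 * dw t * w t - 2 * K * (w t * w t)) * exp (- 2 * K * t)).
assert (Hh : forall t, a <= t <= b ->
  is_derive (fun t => w t * w t * exp (- 2 * K * t)) t (dh t)).
{ intros t Ht; assert (Hwt := Hw t Ht); auto_derive.
  - repeat split; eexists; eassumption.
  - replace (Derive (fun x => w x) t) with (dw t)
      by (symmetry; apply is_derive_unique, Hwt).
    unfold dh; ring. }
destruct (MVT_gen (fun t => w t * w t * exp (- 2 * K * t)) a b dh) as [c [Hc Heq]];
  rewrite Rmin_left, Rmax_right in * by lra.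
- intros t Ht; apply Hh; lra.
- intros t Ht; apply derivable_continuous_pt.
  exists (dh t); apply is_derive_Reals, Hh, Ht.
- rewrite Ha, !Rmult_0_l, Rminus_0_r in Heq.
  assert (Hdh : dh c <= 0).
  { unfold dh.
    assert (dw c * w c <= K * (w c * w c)).
    { apply Rle_trans with (1 := Rle_abs _); rewrite Rabs_mult.
      replace (K * (w c * w c)) with (K * Rabs (w c) * Rabs (w c)).
      - apply Rmult_le_compat_r; auto using Rabs_pos.
      - rewrite Rmult_assoc, <- Rabs_mult, (Rabs_pos_eq (w c * w c)); auto.
        apply Rle_0_sqr. }
    generalize (exp_pos (- 2 * K * c)); nra. }
  assert (Hsq : w b * w b * exp (- 2 * K * b) <= 0) by (rewrite Heq; nra).
  assert (He := exp_pos (- 2 * K * b)).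
  assert (0 <= w b * w b) by apply Rle_0_sqr.
  apply Rsqr_0_uniq; unfold Rsqr; nra.
Qed.

Lemma derivable_bounded (f df : R -> R) (a b : R) : a <= b ->
  (forall t, a <= t <= b -> is_derive f t (df t)) ->
  exists M, forall t, a <= t <= b -> Rabs (f t) <= M.
Proof.
intros Hab Hf.
destruct (continuity_ab_maj (fun t => Rabs (f t)) a b Hab) as [s [Hs _]].
- intros t Ht; apply (continuity_pt_comp f Rabs); [|apply Rcontinuity_abs].
  apply derivable_continuous_pt; exists (df t); apply is_derive_Reals, Hf, Ht.
- exists (Rabs (f s)); exact Hs.
Qed.

(* The reflection s |-> 2 tau - s maps solutions to solutions and fixes the
   value at tau. *)
Lemma reflection_return (p q : R -> R) (D : R) (n : nat) (r : R -> R) (tau l : R) :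
  (forall t, Rabs (p t) <= D) -> (forall t, Rabs (q t) <= D) ->
  0 <= l ->
  (forall t, tau <= t <= tau + l -> p (2 * tau - t) = - p t) ->
  (forall t, tau <= t <= tau + l -> q (2 * tau - t) = - q t) ->
  (forall t, tau - l <= t <= tau + l ->
     is_derive r t (r t * (p t * r t + q t * r t ^ n))) ->
  r (tau + l) = r (tau - l).
Proof.
intros Hp Hq Hl Hsp Hsq Hr.
destruct (derivable_bounded r _ (tau - l) (tau + l) ltac:(lra) Hr) as [M HM].
pose (F := fun t x => x * (p t * x + q t * x ^ n)).
pose (s := fun t => r (2 * tau - t)).
assert (Hs : forall t, tau <= t <= tau + l -> is_derive s t (F t (s t))).
{ intros t Ht.
  replace (F t (s t)) with (scal (-1) (F (2 * tau - t) (s t))).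
  - apply (is_derive_comp r (fun t => 2 * tau - t)).
    + apply Hr; lra.
    + auto_derive; auto; ring.
  - unfold F, scal; simpl; unfold mult; simpl; rewrite Hsp, Hsq by lra; ring. }
assert (H : (fun t => r t - s t) (tau + l) = 0).
{ apply (gronwall_zero (fun t => r t - s t) (fun t => F t (r t) - F t (s t))
    (D * (2 * M + INR (S n) * M ^ n)) tau (tau + l)).
  - lra.
  - intros t Ht; apply (is_derive_minus (V := R_NormedModule)); auto.
    apply Hr; lra.
  - intros t Ht; apply rhs_lipschitz; auto; apply HM; lra.
  - unfold s; replace (2 * tau - tau) with tau by ring; ring. }
unfold s in H; replace (2 * tau - (tau + l)) with (tau - l) in H by ring; lra.
Qed.

Lemma nonneg_integral_zero (f : R -> R) (b t : R) :
  0 < b -> (forall s, continuous f s) -> (forall s, 0 <= f s) ->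
  RInt f 0 b = 0 -> 0 <= t <= b -> f t = 0.
Proof.
intros Hb Hc Hpos Hint Ht.
destruct (Rle_lt_or_eq_dec 0 (f t) (Hpos t)) as [Hlt|]; auto; exfalso.
assert (Hc' := proj2 (continuity_pt_filterlim f t) (Hc t)).
destruct (Hc' (f t) Hlt) as [d [Hd Hnear]].
assert (Hnear' : forall s, Rabs (s - t) < d -> 0 < f s).
{ intros s Hs; destruct (Req_dec s t) as [->|Hne]; auto.
  assert (H := Hnear s); unfold dist in H; simpl in H; unfold Rdist in H.
  assert (H' : Rabs (f s - f t) < f t).
  { apply H; split; auto; split; [exact I|auto]. }
  apply Rabs_lt_between in H'; lra. }
(* Clipping to [0, b] leaves a nondegenerate interval even when [t] is an endpoint. *)
pose (s1 := Rmax 0 (t - d / 2)); pose (s2 := Rmin b (t + d / 2)).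
assert (Hs : 0 <= s1 /\ s1 < s2 /\ s2 <= b /\ t - d / 2 <= s1 /\ s2 <= t + d / 2).
{ unfold s1, s2, Rmax, Rmin; repeat destruct Rle_dec; lra. }
assert (Hex : forall x y, ex_RInt f x y)
  by (intros; apply ex_RInt_everywhere_continuous; auto).
rewrite <- (RInt_Chasles f 0 s1 b), <- (RInt_Chasles f s1 s2 b) in Hint by auto.
assert (H1 : 0 <= RInt f 0 s1) by (apply RInt_ge_0; auto; lra).
assert (H2 : 0 < RInt f s1 s2).
{ apply RInt_gt_0; auto; [lra|].
  intros x Hx; apply Hnear', Rabs_lt_between; lra. }
assert (H3 : 0 <= RInt f s2 b) by (apply RInt_ge_0; auto; lra).
unfold plus in Hint; simpl in Hint; lra.
Qed.

(** * Decomposition of trigonometric forms along a reflection axis *)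

(** Polynomial functions of degree at most n containing only powers of the parity of n. The last
    constructor closes the class under pointwise equality, so no functional extensionality is
    needed. *)
Inductive parity_poly (n : nat) : (R -> R) -> Prop :=
| parity_poly_pow i k : (k + 2 * i = n)%nat -> parity_poly n (fun x => x ^ k)
| parity_poly_add f g : parity_poly n f -> parity_poly n g ->
    parity_poly n (fun x => f x + g x)
| parity_poly_scal a f : parity_poly n f -> parity_poly n (fun x => a * f x)
| parity_poly_ext f g : (forall x, f x = g x) -> parity_poly n f -> parity_poly n g.

Lemma parity_poly_mul_var (n : nat) (f : R -> R) :
  parity_poly n f -> parity_poly (S n) (fun x => x * f x).
Proof.
induction 1 as [i k H|f g _ IHf _ IHg|a f _ IH|f g H _ IH].
- apply (parity_poly_pow (S n) i (S k)); lia.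
- apply parity_poly_ext with (fun x => x * f x + x * g x).
  + intros; ring.
  + now apply parity_poly_add.
- apply parity_poly_ext with (fun x => a * (x * f x)).
  + intros; ring.
  + now apply parity_poly_scal.
- apply parity_poly_ext with (2 := IH); intros x; now rewrite H.
Qed.

Lemma parity_poly_weaken (n : nat) (f : R -> R) :
  parity_poly n f -> parity_poly (S (S n)) f.
Proof.
induction 1 as [i k H|f g _ IHf _ IHg|a f _ IH|f g H _ IH].
- apply (parity_poly_pow (S (S n)) (S i) k); lia.
- now apply parity_poly_add.
- now apply parity_poly_scal.
- now apply parity_poly_ext with (2 := IH).
Qed.

Lemma parity_poly_continuous (n : nat) (f : R -> R) :
  parity_poly n f -> forall x, continuous f x.
Proof.
induction 1 as [i k H|f g _ IHf _ IHg|a f _ IH|f g H _ IH]; intros x.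
- apply (continuous_pow (fun x => x) k), continuous_id.
- apply (continuous_plus (V := R_NormedModule)); auto.
- apply (continuous_mult (K := R_AbsRing)); auto; apply continuous_const.
- apply (continuous_ext f); auto.
Qed.

Lemma parity_poly_integral_zero (n : nat) (f u q : R -> R) (a b : R) :
  parity_poly n f ->
  (forall k i, (k + 2 * i = n)%nat -> is_RInt (fun t => u t ^ k * q t) a b 0) ->
  is_RInt (fun t => f (u t) * q t) a b 0.
Proof.
intros Hf Hu; induction Hf as [i k H|f g _ IHf _ IHg|c f _ IH|f g H _ IH].
- apply (Hu k i H).
- apply (is_RInt_ext (fun t => f (u t) * q t + g (u t) * q t)).
  + intros; ring_R.
  + replace 0 with (0 + 0) by ring.
    now apply (is_RInt_plus (V := R_NormedModule)).
- apply (is_RInt_ext (fun t => c * (f (u t) * q t))).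
  + intros; ring_R.
  + replace 0 with (c * 0) by ring.
    now apply (is_RInt_scal (V := R_NormedModule)).
- apply (is_RInt_ext (fun t => f (u t) * q t)); auto.
  intros; now rewrite H.
Qed.

(** Normal form of a trigonometric form of degree n + 1: in the rotated angle, sin^2 = 1 - cos^2
    leaves sin to the first power at most. Indexing by the degree minus one avoids a subtraction in
    the parity of [O]. *)
Definition trig_decomposable (t0 : R) (n : nat) (f : R -> R) : Prop :=
  exists E O : R -> R, parity_poly (S n) E /\ parity_poly n O /\
  forall t, f t = E (cos (t - t0)) + sin (t - t0) * O (cos (t - t0)).

Lemma trig_decomposable_linear (t0 a b : R) :
  trig_decomposable t0 0 (fun t => a * cos (t - t0) + b * sin (t - t0)).
Proof.
exists (fun x => a * x ^ 1), (fun x => b * x ^ 0); repeat split.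
- apply parity_poly_scal, (parity_poly_pow 1 0); lia.
- apply parity_poly_scal, (parity_poly_pow 0 0); lia.
- intros t; simpl; ring.
Qed.

Lemma trig_decomposable_mul_linear (t0 a b : R) (n : nat) (f : R -> R) :
  trig_decomposable t0 n f ->
  trig_decomposable t0 (S n) (fun t => (a * cos (t - t0) + b * sin (t - t0)) * f t).
Proof.
intros [E [O [HE [HO Hf]]]].
exists (fun x => a * (x * E x) + b * (O x + (-1) * (x * (x * O x)))),
  (fun x => a * (x * O x) + b * E x); split; [|split].
- apply parity_poly_add; apply parity_poly_scal.
  + now apply parity_poly_mul_var.
  + apply parity_poly_add; [now apply parity_poly_weaken|].
    apply parity_poly_scal.
    now apply (parity_poly_mul_var (S n) (fun x => x * O x)), parity_poly_mul_var.
- apply parity_poly_add; apply parity_poly_scal; auto.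
  now apply parity_poly_mul_var.
- intros t; rewrite Hf.
  assert (H := sin2_cos2 (t - t0)); unfold Rsqr in H.
  set (u := cos (t - t0)) in *; set (v := sin (t - t0)) in *.
  transitivity (a * u * E u + b * (v * v) * O u + v * (a * (u * O u) + b * E u)).
  + ring.
  + replace (v * v) with (1 - u * u) by lra; ring.
Qed.

Lemma trig_decomposable_ext (t0 : R) (n : nat) (f g : R -> R) :
  (forall t, f t = g t) -> trig_decomposable t0 n f -> trig_decomposable t0 n g.
Proof.
intros H [E [O [HE [HO Hf]]]]; exists E, O; repeat split; auto.
intros t; now rewrite <- H.
Qed.

(** By the addition formulas, cos t and sin t are linear forms in the rotated cosine and sine, so
    the factors can be multiplied in one at a time. *)
Lemma trig_decomposable_monomial (t0 : R) (n i j : nat) : (i + j = S n)%nat ->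
  trig_decomposable t0 n (fun t => cos t ^ i * sin t ^ j).
Proof.
assert (Hcos : forall t, cos t = cos t0 * cos (t - t0) + (- sin t0) * sin (t - t0)).
{ intros t; replace t with (t0 + (t - t0)) at 1 by ring; rewrite cos_plus; ring. }
assert (Hsin : forall t, sin t = sin t0 * cos (t - t0) + cos t0 * sin (t - t0)).
{ intros t; replace t with (t0 + (t - t0)) at 1 by ring; rewrite sin_plus; ring. }
revert i j; induction n as [|n IH]; intros i j Hij.
- destruct i as [|i].
  + replace j with 1%nat by lia.
    apply trig_decomposable_ext with (2 := trig_decomposable_linear _ (sin t0) (cos t0)).
    intros t; simpl; rewrite <- Hsin; ring.
  + replace i with O by lia; replace j with O by lia.
    apply trig_decomposable_ext with (2 := trig_decomposable_linear _ (cos t0) (- sin t0)).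
    intros t; simpl; rewrite <- Hcos; ring.
- destruct i as [|i].
  + destruct j as [|j]; [lia|].
    apply trig_decomposable_ext with
      (2 := trig_decomposable_mul_linear _ (sin t0) (cos t0) _ _ (IH O j ltac:(lia))).
    intros t; rewrite <- Hsin; simpl; ring.
  + apply trig_decomposable_ext with
      (2 := trig_decomposable_mul_linear _ (cos t0) (- sin t0) _ _ (IH i j ltac:(lia))).
    intros t; rewrite <- Hcos; simpl; ring.
Qed.

Lemma trig_decomposable_add (t0 : R) (n : nat) (f g : R -> R) :
  trig_decomposable t0 n f -> trig_decomposable t0 n g ->
  trig_decomposable t0 n (fun t => f t + g t).
Proof.
intros [E [O [HE [HO Hf]]]] [E' [O' [HE' [HO' Hg]]]].
exists (fun x => E x + E' x), (fun x => O x + O' x); repeat split.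
- now apply parity_poly_add.
- now apply parity_poly_add.
- intros t; rewrite Hf, Hg; ring.
Qed.

Lemma trig_decomposable_scal (t0 a : R) (n : nat) (f : R -> R) :
  trig_decomposable t0 n f -> trig_decomposable t0 n (fun t => a * f t).
Proof.
intros [E [O [HE [HO Hf]]]].
exists (fun x => a * E x), (fun x => a * O x); repeat split.
- now apply parity_poly_scal.
- now apply parity_poly_scal.
- intros t; rewrite Hf; ring.
Qed.

Lemma trig_homogeneous_decomposable (t0 : R) (n : nat) (P : R -> R) :
  trig_homogeneous (S n) P -> trig_decomposable t0 n P.
Proof.
intros [c Hc].
apply trig_decomposable_ext with
  (fun t => sum_f_R0 (fun k => c k * cos t ^ (S n - k) * sin t ^ k) (S n)).
{ intros; now rewrite Hc. }
assert (Hk : forall k, (k <= S n)%nat ->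
  trig_decomposable t0 n (fun t => c k * cos t ^ (S n - k) * sin t ^ k)).
{ intros k Hk.
  apply trig_decomposable_ext with (fun t => c k * (cos t ^ (S n - k) * sin t ^ k)).
  - intros; ring.
  - apply trig_decomposable_scal, trig_decomposable_monomial; lia. }
assert (HN : forall N, (N <= S n)%nat -> trig_decomposable t0 n
  (fun t => sum_f_R0 (fun k => c k * cos t ^ (S n - k) * sin t ^ k) N)).
{ induction N as [|N IH]; intros HN; [apply (Hk O); lia|].
  apply (trig_decomposable_add t0 n
    (fun t => sum_f_R0 (fun k => c k * cos t ^ (S n - k) * sin t ^ k) N)
    (fun t => c (S N) * cos t ^ (S n - S N) * sin t ^ S N)).
  - apply IH; lia.
  - apply Hk; lia. }
apply HN; lia.
Qed.

Lemma trig_homogeneous_bound (n : nat) (P : R -> R) :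
  trig_homogeneous n P -> exists D, forall t, Rabs (P t) <= D.
Proof.
intros [c Hc]; exists (sum_f_R0 (fun k => Rabs (c k)) n); intros t; rewrite Hc.
assert (Hpow : forall x k, -1 <= x <= 1 -> Rabs (x ^ k) <= 1).
{ intros x k Hx; rewrite <- RPow_abs, <- (pow1 k); apply pow_incr.
  split; [apply Rabs_pos|apply Rabs_le_between; lra]. }
replace (sum_f_R0 _ n) with
  (sum_f_R0 (fun k => c k * (cos t ^ (n - k) * sin t ^ k)) n)
  by (apply sum_eq; intros; ring).
apply sum_pow_bound; intros k; rewrite Rabs_mult, <- (Rmult_1_r 1).
apply Rmult_le_compat; auto using Rabs_pos, COS_bound, SIN_bound.
Qed.

Lemma trig_homogeneous_continuous (n : nat) (P : R -> R) :
  trig_homogeneous n P -> forall t, continuous P t.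
Proof.
intros [c Hc] t.
apply (continuous_ext (fun t => sum_f_R0 (fun k => c k * cos t ^ (n - k) * sin t ^ k) n)).
{ intros; now rewrite Hc. }
assert (Hk : forall k, continuous (fun t => c k * cos t ^ (n - k) * sin t ^ k) t).
{ intros k; apply (ex_derive_continuous (fun t => c k * cos t ^ (n - k) * sin t ^ k)).
  auto_derive; auto. }
assert (HN : forall N,
  continuous (fun t => sum_f_R0 (fun k => c k * cos t ^ (n - k) * sin t ^ k) N) t).
{ induction N as [|N IH]; simpl; [apply (Hk O)|].
  apply (continuous_plus (V := R_NormedModule)); auto. }
apply HN.
Qed.

(** The integral of E^2 vanishes, so E does along the period; what remains of [P] is sin (t - t0)
    times a function of cos (t - t0), which is odd about [t0]. *)
Lemma moments_zero_antisymmetric (n : nat) (P : R -> R) (t0 t : R) :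
  trig_homogeneous (S n) P ->
  (forall k i, (k + 2 * i = S n)%nat ->
     RInt (fun s => cos (s - t0) ^ k * P s) 0 (2 * PI) = 0) ->
  0 <= t <= 2 * PI -> P (2 * t0 - t) = - P t.
Proof.
intros HP Hmom Ht.
destruct (trig_homogeneous_decomposable t0 n P HP) as [E [O [HE [HO Hdec]]]].
assert (HEc := parity_poly_continuous _ _ HE).
assert (HOc := parity_poly_continuous _ _ HO).
assert (Hcos : forall s, continuous (fun s => cos (s - t0)) s).
{ intros s; apply (ex_derive_continuous (fun s => cos (s - t0))); auto_derive; auto. }
assert (HEP : is_RInt (fun s => E (cos (s - t0)) * P s) 0 (2 * PI) 0).
{ apply (parity_poly_integral_zero (S n)); auto.
  intros k i Hk.
  assert (H := RInt_correct (V := R_CompleteNormedModule)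
    (fun s => cos (s - t0) ^ k * P s) 0 (2 * PI)).
  rewrite (Hmom k i Hk) in H; apply H.
  apply ex_RInt_everywhere_continuous; intros s.
  apply (continuous_mult (K := R_AbsRing)).
  - now apply continuous_pow.
  - now apply trig_homogeneous_continuous with (S n). }
(* This integrand is exact, with primitive a function of cos (s - t0). *)
assert (HEO : is_RInt (fun s => (- sin (s - t0)) * (E (cos (s - t0)) * O (cos (s - t0))))
  0 (2 * PI) 0).
{ replace 0 with (RInt (fun x => E x * O x) (cos (0 - t0)) (cos (2 * PI - t0))) at 2.
  - apply (is_RInt_comp (V := R_CompleteNormedModule) (fun x => E x * O x)
      (fun s => cos (s - t0)) (fun s => - sin (s - t0))).
    + intros x _; apply (continuous_mult (K := R_AbsRing)); auto.
    + intros x _; split.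
      * auto_derive; auto; unfold Rminus; ring_R.
      * apply (ex_derive_continuous (fun s => - sin (s - t0))); auto_derive; auto.
  - replace (2 * PI - t0) with (0 - t0 + 2 * INR 1 * PI) by (simpl; ring).
    rewrite cos_period, RInt_point; reflexivity. }
(* Since E = P - sin O, the square E^2 is the sum of the two integrands just treated. *)
assert (HE2 : RInt (fun s => E (cos (s - t0)) * E (cos (s - t0))) 0 (2 * PI) = 0).
{ apply is_RInt_unique.
  apply (is_RInt_ext (fun s => E (cos (s - t0)) * P s +
    (- sin (s - t0)) * (E (cos (s - t0)) * O (cos (s - t0))))).
  - intros s _; rewrite Hdec; ring_R.
  - replace 0 with (0 + 0) at 2 by ring.
    now apply (is_RInt_plus (V := R_NormedModule)). }
assert (HEt : E (cos (t - t0)) = 0).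
{ assert (HEE : forall s, continuous (fun s => E (cos (s - t0))) s).
  { intros s; apply (continuous_comp (fun s => cos (s - t0)) E); auto. }
  apply Rsqr_0_uniq.
  apply (nonneg_integral_zero (fun s => E (cos (s - t0)) * E (cos (s - t0))) (2 * PI) t).
  - generalize PI_RGT_0; lra.
  - intros s; apply (continuous_mult (K := R_AbsRing)); auto.
  - intros s; apply Rle_0_sqr.
  - exact HE2.
  - exact Ht. }
rewrite !Hdec.
replace (2 * t0 - t - t0) with (- (t - t0)) by ring.
rewrite cos_neg, sin_neg, HEt; ring.
Qed.

Theorem theorem2p2 (m : nat) (hm : (1 <= m)%nat) (A B : R)
    (hAB : A ^ 2 + B ^ 2 <> 0) (P : R -> R)
    (hP : trig_homogeneous (2 * m + 1) P) :
  is_center (fun t r => r * (P1 A B t * r + P t * r ^ (2 * m + 1))) <->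
  (forall j : nat, (j <= m)%nat ->
     RInt (fun t => P1bar A B t ^ (2 * j + 1) * P t) 0 (2 * PI) = 0).
Proof.
destruct (trig_homogeneous_bound _ _ hP) as [D0 HD0].
pose (D := Rmax D0 (Rabs A + Rabs B + 1)).
assert (HPc := trig_homogeneous_continuous _ _ hP).
assert (HPD : forall t, Rabs (P t) <= D).
{ intros t; apply Rle_trans with (1 := HD0 t), Rmax_l. }
assert (HD1 : Rabs A + Rabs B + 1 <= D) by apply Rmax_r.
assert (Hlin : forall x y, -1 <= x <= 1 -> -1 <= y <= 1 -> Rabs (A * x + B * y) <= D).
{ intros x y Hx Hy; apply Rle_trans with (1 := Rabs_triang _ _).
  rewrite !Rabs_mult.
  apply Rabs_le_between in Hx; apply Rabs_le_between in Hy.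
  generalize (Rabs_pos A) (Rabs_pos B); nra. }
assert (HpD : forall t, Rabs (P1 A B t) <= D).
{ intros t; apply Hlin; [apply COS_bound|apply SIN_bound]. }
assert (HbD : forall t, Rabs (P1bar A B t) <= D).
{ intros t; unfold P1bar; replace (A * sin t - B * cos t) with
    (A * sin t + B * (- cos t)) by ring.
  apply Hlin; [apply SIN_bound|generalize (COS_bound t); lra]. }
split.
- intros Hcenter j Hj.
  apply (center_moments_zero m D (P1 A B) (P1bar A B) P); auto.
  + generalize (Rabs_pos A) (Rabs_pos B); lra.
  + intros t; apply (ex_derive_continuous (P1 A B)); unfold P1; auto_derive; auto.
  + intros t; unfold P1bar, P1; auto_derive; auto; ring.
  + unfold P1bar; rewrite sin_2PI, cos_2PI, sin_0, cos_0; ring.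
  + lia.
- intros Hmom.
  (* [P1] takes the values A and -A at 0 and PI, whose product is not positive. *)
  destruct (IVT_cor (P1 A B) 0 PI) as [t0 [Ht0 Hz]].
  { intros t; apply continuity_pt_filterlim.
    apply (ex_derive_continuous (P1 A B)); unfold P1; auto_derive; auto. }
  { generalize PI_RGT_0; lra. }
  { unfold P1; rewrite sin_0, cos_0, sin_PI, cos_PI.
    generalize (Rle_0_sqr A); unfold Rsqr; lra. }
  set (b0 := P1bar A B t0).
  (* A^2 + B^2 = P1bar^2 + P1^2 at every angle, and [P1] vanishes at [t0]. *)
  assert (Hb0 : b0 <> 0).
  { intros H0; apply hAB.
    assert (Hsc := sin2_cos2 t0); unfold Rsqr in Hsc.
    transitivity ((A ^ 2 + B ^ 2) * (sin t0 * sin t0 + cos t0 * cos t0)).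
    - rewrite Hsc; ring.
    - transitivity (b0 ^ 2 + P1 A B t0 ^ 2); [unfold b0, P1bar, P1; ring|].
      rewrite H0, Hz; ring. }
  assert (Hbar : forall t, P1bar A B t = b0 * cos (t - t0)).
  { intros t.
    transitivity (b0 * cos (t - t0) + P1 A B t0 * sin (t - t0)).
    - unfold b0, P1bar, P1; replace t with (t0 + (t - t0)) at 1 2 by ring.
      rewrite sin_plus, cos_plus; ring.
    - rewrite Hz; ring. }
  assert (Hp : forall t, P1 A B t = - b0 * sin (t - t0)).
  { intros t.
    transitivity (P1 A B t0 * cos (t - t0) - b0 * sin (t - t0)).
    - unfold b0, P1bar, P1; replace t with (t0 + (t - t0)) at 1 2 by ring.
      rewrite sin_plus, cos_plus; ring.
    - rewrite Hz; ring. }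
  assert (Hanti : forall t, 0 <= t <= 2 * PI -> P (2 * t0 - t) = - P t).
  { intros t Ht; apply (moments_zero_antisymmetric (2 * m)); auto.
    - now replace (S (2 * m)) with (2 * m + 1)%nat by lia.
    - intros k i Hk.
      (* The parity condition makes k odd and at most 2m + 1, so k = 2 (m - i) + 1 is one of the
         given moments, up to the factor b0^k. *)
      assert (Hj := Hmom (m - i)%nat ltac:(lia)).
      replace (2 * (m - i) + 1)%nat with k in Hj by lia.
      rewrite (RInt_ext _ (fun s => scal (b0 ^ k) (cos (s - t0) ^ k * P s))) in Hj.
      + rewrite (RInt_scal (V := R_CompleteNormedModule)
          (fun s => cos (s - t0) ^ k * P s)) in Hj.
        * apply Rmult_integral in Hj; destruct Hj as [Hj|Hj]; auto.
          exfalso; apply (pow_nonzero b0 k Hb0 Hj).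
        * apply ex_RInt_everywhere_continuous; intros s.
          apply (continuous_mult (K := R_AbsRing)); auto.
          apply (ex_derive_continuous (fun s => cos (s - t0) ^ k)).
          auto_derive; auto.
      + intros s _; rewrite Hbar, Rpow_mult_distr.
        unfold scal; simpl; unfold mult; simpl; ring. }
  assert (Hper : forall t, P (t + 2 * PI) = P t).
  { destruct hP as [c Hc]; intros t; rewrite !Hc; apply sum_eq; intros k _.
    replace (t + 2 * PI) with (t + 2 * INR 1 * PI) by (simpl; ring).
    now rewrite cos_period, sin_period. }
  (* The reflections act on every solution over the period, so any positive radius will do. *)
  exists 1; split; [lra|]; intros r Hr _.
  (* The period splits into [0, 2 t0], centred at t0, and [2 t0, 2 PI], centred at t0 + PI; both lie
     in [0, 2 PI] because t0 is in [0, PI]. *)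
  assert (H1 : r (t0 + t0) = r (t0 - t0)).
  { apply (reflection_return (P1 A B) P D (2 * m + 1) r t0 t0); auto; try lra.
    - intros t _; rewrite !Hp; replace (2 * t0 - t - t0) with (- (t - t0)) by ring.
      rewrite sin_neg; ring.
    - intros t Ht; apply Hanti; lra.
    - intros t Ht; apply Hr; lra. }
  assert (H2 : r (t0 + PI + (PI - t0)) = r (t0 + PI - (PI - t0))).
  { apply (reflection_return (P1 A B) P D (2 * m + 1) r (t0 + PI) (PI - t0));
      auto; try lra.
    - intros t _; rewrite !Hp.
      replace (2 * (t0 + PI) - t - t0) with (- (t - t0) + 2 * INR 1 * PI)
        by (simpl; ring).
      rewrite sin_period, sin_neg; ring.
    - intros t Ht; replace (2 * (t0 + PI) - t) with (2 * t0 - t + 2 * PI) by ring.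
      rewrite Hper; apply Hanti; lra.
    - intros t Ht; apply Hr; lra. }
  replace (t0 + PI + (PI - t0)) with (2 * PI) in H2 by ring.
  replace (t0 + PI - (PI - t0)) with (t0 + t0) in H2 by ring.
  rewrite H2, H1, Rminus_diag; reflexivity.
Qed.
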